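(* Let $(H,R)$ be a quasitriangular Hopf algebra satisfying: (i) $G(H)\cap Z(H)=\{1\}$; (ii) $|G(H)|=2m-1$ for some $m\in\mathbb N$; (iii) $S^{2n}=\mathrm{Id}$ for some odd number $n$. Then the element $\mathrm g^{-m}u$ is the unique ribbon element of $(H,R)$, where $\mathrm g=uS(u^{-1})$.
   Context: All Hopf algebras are finite-dimensional over an algebraically closed field $\Bbbk$ of characteristic $0$. $G(H)$ is the group of group-like elements, $Z(H)$ the center, $S$ the antipode of $H$. A quasitriangular Hopf algebra is $(H,R)$ with $R\in H\otimes H$ invertible, $(\Delta\otimes\mathrm{Id})(R)=R_{13}R_{23}$, $(\mathrm{Id}\otimes\Delta)(R)=R_{13}R_{12}$, $\Delta^{op}(h)R=R\Delta(h)$. Writing $R=\sum_iR_i\otimes R^i$, put $u=\sum_iS(R^i)R_i$. A ribbon element of $(H,R)$ is a central element $v\in H$ with $v^2=uS(u)$, $S(v)=v$, $\epsilon(v)=1$, $\Delta(v)=(v\otimes v)(R_{21}R)^{-1}$. *)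

(* Defs.v *)
From HB Require Import structures.
From mathcomp Require Import all_boot all_order all_algebra all_field.
From mathcomp Require Import mathcomp_extra boolp classical_sets functions.
From mathcomp Require Import cardinality.

Set Implicit Arguments.
Unset Strict Implicit.
Unset Printing Implicit Defensive.

Import GRing.Theory.

Local Open Scope ring_scope.

(* The tensor product of two finite-dimensional spaces, presented by           *)
(* coordinate matrices in the bases e_i (x) f_j, where e and f are the library *)
(* bases of the factors. Lemmas tliftE and tens_ext below are its universal    *)
(* property, so nothing depends on the choice of bases.                        *)
Definition tensor (K : fieldType) (U V : vectType K) : Type :=
  'M[K]_(\dim {:U}, \dim {:V}).

HB.instance Definition _ (K : fieldType) (U V : vectType K) :=
  Vector.copy (tensor U V) 'M[K]_(\dim {:U}, \dim {:V}).

Definition tens (K : fieldType) (U V : vectType K) (u : U) (v : V) :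
    tensor U V :=
  \matrix_(i, j) (coord (vbasis {:U}) i u * coord (vbasis {:V}) j v).

Notation "u \ox v" := (tens u v)
  (at level 40, left associativity, format "u  \ox  v") : ring_scope.

(* tlift f is the linear map sending u \ox v to f u v when f is bilinear; for  *)
(* t = \sum_k (a_k \ox b_k) it is thus \sum_k f a_k b_k.                       *)
Definition tlift (K : fieldType) (U V W : vectType K) (f : U -> V -> W)
    (t : tensor U V) : W :=
  \sum_i \sum_j (t : 'M[K]_(_, _)) i j *: f (vbasis {:U})`_i (vbasis {:V})`_j.

Definition bilin (K : fieldType) (U V W : vectType K) (f : U -> V -> W) : Prop :=
  (forall u, linear (f u)) /\ (forall v, linear (f^~ v)).

Section TensorTheory.
Variable K : fieldType.
Implicit Types U V W : vectType K.

Lemma tens_linearr U V (u : U) : linear (tens u : V -> tensor U V).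
Proof.
move=> a x y; apply/matrixP=> i j; rewrite !mxE linearP /=.
by rewrite mulrDr mulrCA.
Qed.

Lemma tens_linearl U V (v : V) : linear ((@tens K U V)^~ v).
Proof.
move=> a x y; apply/matrixP=> i j; rewrite !mxE linearP /=.
by rewrite mulrDl mulrA.
Qed.

Lemma tens_bilin U V : bilin (@tens K U V).
Proof. by split=> ?; [apply: tens_linearr | apply: tens_linearl]. Qed.

Lemma tlift_linear U V W (f : U -> V -> W) : linear (tlift f).
Proof.
move=> a s t; rewrite /tlift scaler_sumr -big_split; apply: eq_bigr => i _.
rewrite scaler_sumr -big_split; apply: eq_bigr => j _ /=.
by rewrite !mxE scalerDl scalerA.
Qed.

HB.instance Definition _ U V W (f : U -> V -> W) :=
  GRing.isLinear.Build K (tensor U V) W *:%R (tlift f) (tlift_linear f).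

Lemma tliftE U V W (f : U -> V -> W) (u : U) (v : V) :
  bilin f -> tlift f (u \ox v) = f u v.
Proof.
case=> fr fl.
pose fu u := GRing.isLinear.Build K V W *:%R (f u) (fr u).
pose Fu u : {linear V -> W} := HB.pack (f u) (fu u).
pose fv v := GRing.isLinear.Build K U W *:%R (f^~ v) (fl v).
pose Fv v : {linear U -> W} := HB.pack (f^~ v) (fv v).
rewrite /tlift; have -> : f u v = Fv v u by [].
rewrite [in RHS](coord_vbasis (memvf u)) linear_sum; apply: eq_bigr => i _.
rewrite linearZ /=; set e := (vbasis _)`_i.
have -> : f e v = Fu e v by [].
rewrite [in RHS](coord_vbasis (memvf v)) linear_sum scaler_sumr.
by apply: eq_bigr => j _; rewrite linearZ /= scalerA mxE.
Qed.

Lemma tensor_sum U V (t : tensor U V) :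
  t = \sum_i \sum_j t i j *: ((vbasis {:U})`_i \ox (vbasis {:V})`_j).
Proof.
have free X : free (vbasis {:X : vectType K}).
  exact: basis_free (vbasisP _).
apply/matrixP=> k l; rewrite summxE (bigD1 k) //= summxE (bigD1 l) //=.
rewrite !big1 ?addr0 => [|i ik|j jl]; last 2 first.
- rewrite summxE big1 // => j _.
  by rewrite !mxE !coord_free // (negPf ik) mul0r mulr0.
- by rewrite !mxE !coord_free // (negPf jl) !mulr0.
by rewrite !mxE !coord_free // !eqxx !mulr1.
Qed.

Lemma tens_ext U V W (f g : tensor U V -> W) : linear f -> linear g ->
  (forall u v, f (u \ox v) = g (u \ox v)) -> f =1 g.
Proof.
move=> lf lg fg t.
pose F : {linear _ -> _} := HB.pack f (GRing.isLinear.Build K _ W *:%R f lf).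
pose G : {linear _ -> _} := HB.pack g (GRing.isLinear.Build K _ W *:%R g lg).
rewrite -[f t]/(F t) -[g t]/(G t) (tensor_sum t) !linear_sum.
apply: eq_bigr => i _; rewrite !linear_sum; apply: eq_bigr => j _.
by rewrite !linearZ /= fg.
Qed.

Lemma tlift_fun_linear U V W (f g h : U -> V -> W) k (t : tensor U V) :
  (forall u v, h u v = k *: f u v + g u v) ->
  tlift h t = k *: tlift f t + tlift g t.
Proof.
move=> hE; rewrite /tlift scaler_sumr -big_split; apply: eq_bigr => i _ /=.
rewrite scaler_sumr -big_split; apply: eq_bigr => j _ /=.
by rewrite hE scalerDr !scalerA mulrC.
Qed.

End TensorTheory.

Section TensorMaps.
Variable K : fieldType.

Definition tmap (U V U' V' : vectType K) (f : U -> U') (g : V -> V') :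
    tensor U V -> tensor U' V' :=
  tlift (fun u v => f u \ox g v).

Definition tswap (U V : vectType K) : tensor U V -> tensor V U :=
  tlift (fun u v => v \ox u).

Definition tassoc (U V W : vectType K) :
    tensor (tensor U V) W -> tensor U (tensor V W) :=
  tlift (fun s w => tlift (fun u v => u \ox (v \ox w)) s).

End TensorMaps.

Section TensorAlgebra.
Variables (K : fieldType) (A B : falgType K).
Implicit Types s t r : tensor A B.

Definition tone : tensor A B := 1 \ox 1.

(* (a \ox b) * (c \ox d) = (a * c) \ox (b * d), extended bilinearly. *)
Definition tmul s t : tensor A B :=
  tlift (fun a b => tlift (fun c d => (a * c) \ox (b * d)) t) s.

Lemma tmul_linearl t : linear (tmul^~ t).
Proof. exact: tlift_linear. Qed.

Let mulr_lin (C : falgType K) (a : C) : linear ( *%R a).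
Proof. by move=> k y z; rewrite mulrDr scalerAr. Qed.

Let mull_lin (C : falgType K) (a : C) : linear ( *%R^~ a).
Proof. by move=> k y z; rewrite mulrDl scalerAl. Qed.

Lemma tmul_linearr s : linear (tmul s).
Proof.
move=> k x y; apply: tlift_fun_linear => a b; exact: tlift_linear.
Qed.

Lemma tmulE a b c d : tmul (a \ox b) (c \ox d) = (a * c) \ox (b * d).
Proof.
rewrite /tmul tliftE ?tliftE //; split=> [x k y z|x k y z] /=.
- by rewrite mulr_lin tens_linearr.
- by rewrite mulr_lin tens_linearl.
- by apply: tlift_fun_linear => u v; rewrite mull_lin tens_linearr.
- by apply: tlift_fun_linear => u v; rewrite mull_lin tens_linearl.
Qed.

Lemma tmulA : associative tmul.
Proof.
move=> s t r; move: r; apply: tens_ext => [||a b].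
- by move=> k x y; rewrite !tmul_linearr.
- by move=> k x y; rewrite !tmul_linearr.
move: t; apply: tens_ext => [||c d].
- by move=> k x y; rewrite !(tmul_linearl, tmul_linearr).
- by move=> k x y; rewrite !(tmul_linearl, tmul_linearr).
move: s; apply: tens_ext => [||e f].
- by move=> k x y; rewrite !tmul_linearl.
- by move=> k x y; rewrite !tmul_linearl.
by rewrite !tmulE !mulrA.
Qed.

Lemma tmul1r : left_id tone tmul.
Proof.
apply: tens_ext => [|k x y|a b]; [exact: tmul_linearr | by [] |].
by rewrite tmulE !mul1r.
Qed.

Lemma tmulr1 : right_id tone tmul.
Proof.
apply: tens_ext => [|k x y|a b]; [exact: tmul_linearl | by [] |].
by rewrite tmulE !mulr1.
Qed.

Lemma tmulDl : left_distributive tmul +%R.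
Proof. by move=> x y t; have := tmul_linearl t 1 x y; rewrite !scale1r. Qed.

Lemma tmulDr : right_distributive tmul +%R.
Proof. by move=> s x y; have := tmul_linearr s 1 x y; rewrite !scale1r. Qed.

Lemma tone_neq0 : tone != 0.
Proof.
have nz (C : falgType K) : exists i, coord (vbasis {:C}) i 1 != 0.
  apply/existsP; apply: contraT; rewrite negb_exists => /forallP c0.
  have /eqP[] := oner_neq0 C; rewrite (coord_vbasis (memvf 1)) big1 // => i _.
  by have /negPn/eqP-> := c0 i; rewrite scale0r.
have [[i ai] [j bj]] := (nz A, nz B); apply/eqP => /matrixP/(_ i j)/eqP.
by rewrite !mxE mulf_eq0 (negPf ai) (negPf bj).
Qed.

HB.instance Definition _ := GRing.Zmodule_isNzRing.Build (tensor A B)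
  tmulA tmul1r tmulr1 tmulDl tmulDr tone_neq0.

Lemma tscaleAl (k : K) s t : k *: (s * t) = (k *: s) * t.
Proof.
by have := tmul_linearl t k s 0; rewrite addr0 /= => E; rewrite [RHS]E -[tmul 0 t]/(0 * t) mul0r addr0.
Qed.

HB.instance Definition _ :=
  GRing.Lmodule_isLalgebra.Build K (tensor A B) tscaleAl.

Lemma tscaleAr (k : K) s t : k *: (s * t) = s * (k *: t).
Proof.
by have := tmul_linearr s k t 0; rewrite addr0 /= => E; rewrite [RHS]E -[tmul s 0]/(s * 0) mulr0 addr0.
Qed.

HB.instance Definition _ :=
  GRing.Lalgebra_isAlgebra.Build K (tensor A B) tscaleAr.

HB.instance Definition _ := Algebra_isFalgebra.Build K (tensor A B).

Lemma tens1 : (1 : A) \ox (1 : B) = 1.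
Proof. by []. Qed.

Lemma tensM (a c : A) (b d : B) : (a \ox b) * (c \ox d) = (a * c) \ox (b * d).
Proof. exact: tmulE. Qed.

End TensorAlgebra.

HB.mixin Record isHopf (K : fieldType) H of Falgebra K H := {
  comul : {lrmorphism H -> tensor H H};
  counit : {lrmorphism H -> K^o};
  antipode : {linear H -> H};
  comulA : forall h : H,
    tassoc (tmap comul idfun (comul h)) = tmap idfun comul (comul h);
  counitl : forall h : H, tlift (fun a b => counit a *: b) (comul h) = h;
  counitr : forall h : H, tlift (fun a b => counit b *: a) (comul h) = h;
  antipodel : forall h : H,
    tlift (fun a b => antipode a * b) (comul h) = (counit h : K)%:A;
  antipoder : forall h : H,
    tlift (fun a b => a * antipode b) (comul h) = (counit h : K)%:A
}.

#[short(type="hopfAlgType")]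
HB.structure Definition Hopf (K : fieldType) :=
  { H of isHopf K H & Falgebra K H }.

Section Quasitriangular.
Variables (K : fieldType) (H : hopfAlgType K).
Implicit Types (R : tensor H H) (g u v : H).

Definition group_likes : set H :=
  [set g : H | g != 0 /\ comul g = g \ox g]%classic.

Definition leg12 R : tensor (tensor H H) H := R \ox 1.
Definition leg13 R : tensor (tensor H H) H :=
  tlift (fun a b => (a \ox 1) \ox b) R.
Definition leg23 R : tensor (tensor H H) H :=
  tlift (fun a b => (1 \ox a) \ox b) R.

Record quasitriangular R : Prop := Quasitriangular {
  qt_unit : R \is a GRing.unit;
  qt_comull : tmap comul idfun R = leg13 R * leg23 R;
  qt_comulr : tmap idfun comul R = tassoc (leg13 R * leg12 R);
  qt_comul_op : forall h : H, tswap (comul h) * R = R * comul h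
}.

Definition drinfeld R : H := tlift (fun a b => antipode b * a) R.

Record is_ribbon R v : Prop := IsRibbon {
  ribbon_central : v \in 'Z({:H})%VS;
  ribbon_sqr : v ^+ 2 = drinfeld R * antipode (drinfeld R);
  ribbon_antipode : antipode v = v;
  ribbon_counit : counit v = 1;
  ribbon_comul : comul v = (v \ox v) * (tswap R * R)^-1
}.

End Quasitriangular.

Arguments group_likes {K} H.

(* Main.v *)
Require Import Defs.
From HB Require Import structures.
From mathcomp Require Import all_boot all_order all_algebra all_field.
From mathcomp Require Import fingroup cyclic finmap.
From mathcomp Require Import mathcomp_extra boolp classical_sets functions.
From mathcomp Require Import cardinality.

(** Write S for the antipode, u for the Drinfeld element, Q = R_21 R for the
    monodromy and g = u S(u)^-1.

    The structural input is Drinfeld's theory of u: u is invertible and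
    implements S^2, that is S^2(h) u = u h ([drinfeld_antipode2],
    [drinfeld_unit]), and Q Delta(u) = u (x) u ([comul_drinfeld]).  Applying S
    to these identities gives S(u) S^2(k) = k S(u) and
    Delta(S(u)) Q = S(u) (x) S(u); as Q commutes with every coproduct, dividing
    one pair by the other shows that g is group-like ([quotient_group_like])
    and that S^4 is conjugation by g ([antipode4_conj]).

    Hence a ribbon element is the same thing as l^-1 u where l is a group-like
    square root of g such that conjugation by l is S^2: the equations for v^2
    and Delta(v) say that l = u v^-1 is a group-like square root of g, and
    centrality of v says that l and u induce the same conjugation.  The
    group-likes form a group of odd order 2m - 1, so by Lagrange's theorem
    ([group_like_expr]) x^(2m) = x for every group-like x.  The only group-like
    square root of g is therefore g^m, which is uniqueness.

    For existence one must see that conjugation by g^m is S^2.  Let n = 2k + 1.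
    Conjugation by g^n is S^(4n) = Id, so g^n is a central group-like, whence
    g^n = 1 by (i); then g^(n+1) = g, so that g^m and g^(k+1) are both square
    roots of g and coincide.  Conjugation by g^(k+1) is
    S^(4(k+1)) = S^(2n) S^2 = S^2.

    Tensors are handled through sums over their components, in the spirit of
    Sweedler's notation: an identity between tensors becomes an equality of sums
    of values of an arbitrary multilinear map, and each computation consists of
    such rewritings. *)

Set Implicit Arguments.
Unset Strict Implicit.
Unset Printing Implicit Defensive.

Import GRing.Theory.

Local Open Scope classical_set_scope.
Local Open Scope card_scope.
Local Open Scope ring_scope.

(** * Linearity of expressions *)

Local Notation "'\tsum_' ( a , b <- t ) F" := (tlift (fun a b => F) t)
  (at level 41, F at level 41, t at level 41, a name, b name,
   format "'[' \tsum_ ( a ,  b  <-  t ) '/  '  F ']'") : ring_scope.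

Definition trilin (K : fieldType) (U V W X : vectType K)
    (f : U -> V -> W -> X) : Prop :=
  [/\ forall v w, linear (fun u => f u v w),
      forall u w, linear (fun v => f u v w) &
      forall u v, linear (f u v)].

Section Linearity.
Variable K : fieldType.
Implicit Types U V W X : vectType K.

Lemma lin_id U : linear (fun x : U => x).
Proof. by []. Qed.

Lemma lin_app U V W (F : V -> W) (f : U -> V) :
  linear F -> linear f -> linear (fun x => F (f x)).
Proof. by move=> lF lf k x y; rewrite lf lF. Qed.

Lemma lin_map V W (F : {linear V -> W}) : linear F.
Proof. exact: linearP. Qed.

Lemma lin_scalel U V (f : U -> K^o) (v : V) :
  linear f -> linear (fun x => (f x : K) *: v).
Proof. by move=> lf k x y; rewrite lf scalerDl scalerA. Qed.

Lemma lin_scaler U V (f : U -> V) (c : K) :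
  linear f -> linear (fun x => c *: f x).
Proof. by move=> lf k x y; rewrite lf scalerDr !scalerA mulrC. Qed.

Lemma lin_mull U (A : falgType K) (f : U -> A) (c : A) :
  linear f -> linear (fun x => f x * c).
Proof. by move=> lf k x y; rewrite lf mulrDl scalerAl. Qed.

Lemma lin_mulr U (A : falgType K) (f : U -> A) (c : A) :
  linear f -> linear (fun x => c * f x).
Proof. by move=> lf k x y; rewrite lf mulrDr scalerAr. Qed.

Lemma lin_tensl U V W (f : U -> V) (w : W) :
  linear f -> linear (fun x => f x \ox w).
Proof. exact: (lin_app (@tens_linearl _ _ _ w)). Qed.

Lemma lin_tensr U V W (f : U -> V) (w : W) :
  linear f -> linear (fun x => w \ox f x).
Proof. exact: (lin_app (@tens_linearr _ _ _ w)). Qed.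

Lemma lin_tliftl U V W X (f : U -> V -> W -> X) (t : tensor V W) :
  (forall a b, linear (fun x => f x a b)) ->
  linear (fun x => tlift (f x) t).
Proof. by move=> lf k x y; apply: tlift_fun_linear => a b; apply: lf. Qed.

Lemma lin_tliftr U V W X (f : V -> W -> X) (t : U -> tensor V W) :
  linear t -> linear (fun x => tlift f (t x)).
Proof. exact: (lin_app (@tlift_linear _ _ _ _ f)). Qed.

Lemma lin_bilinl U V W X (f : V -> W -> X) (g : U -> V) (w : W) :
  bilin f -> linear g -> linear (fun x => f (g x) w).
Proof. by case=> _ fl; exact: (lin_app (fl w)). Qed.

Lemma lin_bilinr U V W X (f : V -> W -> X) (g : U -> W) (v : V) :
  bilin f -> linear g -> linear (fun x => f v (g x)).
Proof. by case=> fr _; exact: (lin_app (fr v)). Qed.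

Lemma linZ U V (f : U -> V) : linear f -> forall k x, f (k *: x) = k *: f x.
Proof.
move=> lf k x; pose F : {linear U -> V} :=
  HB.pack f (GRing.isLinear.Build K U V *:%R f lf).
exact: (linearZ_LR F).
Qed.

End Linearity.

(** The head symbol of the function selects the lemma: if the lemmas were tried
    in turn, unification would unfold the products of tensor algebras. A part
    that should be constant is passed explicitly, so that a branch fails at once
    when this part depends on the bound variable. *)
Local Ltac lin_step :=
  match goal with
  | |- forall _, _ => intro
  | |- GRing.linear_for _ (fun x => x) => exact: lin_id
  | |- GRing.linear_for _ (fun x => GRing.scale (@?f x) ?v) =>
      refine (lin_scalel (f := f) v _)
  | |- GRing.linear_for _ (fun x => GRing.scale ?k (@?f x)) =>
      refine (lin_scaler (f := f) k _)
  | |- GRing.linear_for _ (fun x => GRing.mul (@?f x) ?c) =>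
      refine (lin_mull (f := f) c _)
  | |- GRing.linear_for _ (fun x => GRing.mul ?c (@?f x)) =>
      refine (lin_mulr (f := f) c _)
  | |- GRing.linear_for _ (fun x => tens (@?f x) ?w) =>
      refine (lin_tensl (f := f) w _)
  | |- GRing.linear_for _ (fun x => tens ?w (@?f x)) =>
      refine (lin_tensr (f := f) w _)
  | |- GRing.linear_for _ (fun x => tlift ?g (@?t x)) =>
      refine (lin_tliftr g (t := t) _)
  | |- GRing.linear_for _ (fun x => tlift (@?g x) ?t) =>
      refine (lin_tliftl (f := g) t _)
  | |- GRing.linear_for _ (GRing.mul ?c) => exact: (lin_mulr c (@lin_id _ _))
  | |- GRing.linear_for _ (GRing.scale ?k) =>
      exact: (lin_scaler k (@lin_id _ _))
  | |- GRing.linear_for _ (tens _) => exact: tens_linearr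
  | |- GRing.linear_for _ (tlift _) => exact: tlift_linear
  | bf : bilin ?f |- GRing.linear_for _ (fun x => ?f (@?g x) ?w) =>
      refine (lin_bilinl w bf (g := g) _)
  | bf : bilin ?f |- GRing.linear_for _ (fun x => ?f ?w (@?g x)) =>
      refine (lin_bilinr w bf (g := g) _)
  | |- _ => first [ done | exact: lin_map
                  | apply: (lin_app (@lin_map _ _ _ _)) ]
  end.
Local Ltac lin := intros; cbv beta; repeat (lin_step; cbv beta).

(** * Sums over the components of a tensor *)

Section TensorSums.
Variable K : fieldType.
Implicit Types U V W X : vectType K.

Lemma tlift_app U V W X (F : W -> X) (f : U -> V -> W) (t : tensor U V) :
  linear F -> F (tlift f t) = \tsum_(a, b <- t) F (f a b).
Proof.
move=> lF; pose G : {linear _ -> _} :=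
  HB.pack F (GRing.isLinear.Build K W X *:%R F lF).
rewrite -[F _]/(G _) linear_sum; apply: eq_bigr => i _.
by rewrite linear_sum; apply: eq_bigr => j _; rewrite linearZ.
Qed.

Lemma tlift_tens U V (t : tensor U V) : \tsum_(a, b <- t) (a \ox b) = t.
Proof. by rewrite [RHS]tensor_sum. Qed.

Lemma eq_tlift U V W (f g : U -> V -> W) (t : tensor U V) :
  (forall a b, f a b = g a b) -> tlift f t = tlift g t.
Proof.
by move=> fg; apply: eq_bigr => i _; apply: eq_bigr => j _; rewrite fg.
Qed.

Lemma exchange_tlift U V U' V' W (f : U -> V -> U' -> V' -> W)
    (s : tensor U V) (t : tensor U' V') :
  \tsum_(a, b <- s) \tsum_(c, d <- t) f a b c d =
  \tsum_(c, d <- t) \tsum_(a, b <- s) f a b c d.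
Proof.
have tliftZ I (r : seq I) (k : I -> K) (g : I -> U -> V -> W) :
    \tsum_(a, b <- s) (\sum_(i <- r) k i *: g i a b) =
    \sum_(i <- r) k i *: tlift (g i) s.
  elim: r => [|i r IHr].
    rewrite big_nil /tlift big1 // => i _; rewrite big1 // => j _.
    by rewrite big_nil scaler0.
  rewrite big_cons -IHr; apply: tlift_fun_linear => a b.
  by rewrite big_cons.
under [LHS]eq_tlift do rewrite /tlift pair_big.
by rewrite tliftZ [RHS]/tlift pair_big.
Qed.

Lemma tlift_swap U V W (f : V -> U -> W) (t : tensor U V) :
  bilin f -> tlift f (tswap t) = \tsum_(a, b <- t) f b a.
Proof.
move=> bf; rewrite (tlift_app _ _ (@tlift_linear _ _ _ _ f)).
by apply: eq_tlift => a b; rewrite tliftE.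
Qed.

Lemma tlift_map U V U' V' W (f : U' -> V' -> W) (g : U -> U') (h : V -> V')
    (t : tensor U V) :
  bilin f -> tlift f (tmap g h t) = \tsum_(a, b <- t) f (g a) (h b).
Proof.
move=> bf; rewrite (tlift_app _ _ (@tlift_linear _ _ _ _ f)).
by apply: eq_tlift => a b; rewrite tliftE.
Qed.

Lemma tlift_assoc U V W X (f : U -> V -> W -> X) t : trilin f ->
  \tsum_(a, s <- tassoc t) \tsum_(b, c <- s) f a b c =
  \tsum_(s, c <- t) \tsum_(a, b <- s) f a b c.
Proof.
case=> f1 f2 f3; rewrite (tlift_app _ _ (@tlift_linear _ _ _ _ _)).
apply: eq_tlift => s c; rewrite (tlift_app _ _ (@tlift_linear _ _ _ _ _)).
apply: eq_tlift => a b; rewrite tliftE; last by split; lin.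
by apply: tliftE; split; lin.
Qed.

Lemma tlift_mul (A B : falgType K) W (f : A -> B -> W) (s t : tensor A B) :
  bilin f ->
  tlift f (s * t) = \tsum_(a, b <- s) \tsum_(c, d <- t) f (a * c) (b * d).
Proof.
move=> bf; rewrite (tlift_app _ _ (@tlift_linear _ _ _ _ f)).
apply: eq_tlift => a b; rewrite (tlift_app _ _ (@tlift_linear _ _ _ _ f)).
by apply: eq_tlift => c d; rewrite tliftE.
Qed.

Lemma tmulr_tens (A B : falgType K) (t : tensor A B) x y :
  t * (x \ox y) = \tsum_(a, b <- t) ((a * x) \ox (b * y)).
Proof.
rewrite -[in LHS](tlift_tens t) (tlift_app (F := fun t => t * _)); last by lin.
by apply: eq_tlift => a b; rewrite tensM.
Qed.

Lemma tmull_tens (A B : falgType K) (t : tensor A B) x y :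
  (x \ox y) * t = \tsum_(a, b <- t) ((x * a) \ox (y * b)).
Proof.
rewrite -[in LHS](tlift_tens t) (tlift_app (F := fun t => _ * t)); last by lin.
by apply: eq_tlift => a b; rewrite tensM.
Qed.

Lemma tswapM (A B : falgType K) : {morph @tswap K A B : s t / s * t}.
Proof.
move=> s t; rewrite /tswap tlift_mul; last by split; lin.
rewrite [RHS](tlift_app (F := fun z => z * _)); last by lin.
apply: eq_tlift => a b.
rewrite [RHS](tlift_app (F := fun z => _ * z)); last by lin.
by apply: eq_tlift => c d; rewrite tensM.
Qed.

Lemma tswapK U V : cancel (@tswap K U V) (@tswap K V U).
Proof.
move=> t; rewrite /tswap tlift_swap; last by split; lin.
exact: tlift_tens.
Qed.

Lemma tswap_tens U V (x : U) (y : V) : tswap (x \ox y) = y \ox x.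
Proof. by rewrite /tswap tliftE //; split; lin. Qed.

End TensorSums.

(** * Units of finite-dimensional algebras *)

Section FalgUnits.
Variable K : fieldType.

(** In finite dimension, left multiplication by x is bijective as soon as it is
    surjective. *)
Lemma falg_unitr (A : falgType K) (x y : A) : x * y = 1 -> x \is a GRing.unit.
Proof.
move=> xy1.
have im : limg (amull x) = fullv.
  apply/vspaceP => v; rewrite memvf; apply/memv_imgP; exists (y * v).
    exact: memvf.
  by rewrite lfunE /= mulrA xy1 mul1r.
have ker0 : lker (amull x) == 0%VS.
  rewrite -dimv_eq0; have := limg_ker_dim (amull x) fullv.
  by rewrite im capfv -{2}[\dim {:A}]add0n => /addIn->.
apply/unitrP; exists y; split=> //; apply: (lker0P ker0).
by rewrite !lfunE /= mulrA xy1 mul1r mulr1.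
Qed.

Lemma falg_invr (A : falgType K) (x y : A) : x * y = 1 -> x^-1 = y.
Proof.
by move=> xy1; apply: (mulrI (falg_unitr xy1)); rewrite mulrV ?(falg_unitr xy1).
Qed.

Lemma tens_unit (A B : falgType K) (x : A) (y : B) :
  x \is a GRing.unit -> y \is a GRing.unit -> x \ox y \is a GRing.unit.
Proof.
move=> Ux Uy; apply: (@falg_unitr _ _ (x^-1 \ox y^-1)).
by rewrite tensM !mulrV.
Qed.

Lemma tens_inv (A B : falgType K) (x : A) (y : B) :
  x \is a GRing.unit -> y \is a GRing.unit ->
  (x \ox y)^-1 = x^-1 \ox y^-1.
Proof. by move=> Ux Uy; apply: falg_invr; rewrite tensM !mulrV. Qed.

End FalgUnits.

Lemma unitr_mul_fixed (A : unitRingType) (x y : A) :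
  x \is a GRing.unit -> x = x * y -> y = 1.
Proof. by move=> Ux e; apply: (mulrI Ux); rewrite -e mulr1. Qed.

(** * The antipode *)

Section Antipode.
Variables (K : fieldType) (H : hopfAlgType K).
Implicit Types (a b h x : H) (W : vectType K).

Notation S := (@antipode K H).
Notation eps := (@counit K H).

Lemma tlift_coassoc W (f : H -> H -> H -> W) h : trilin f ->
  \tsum_(a, b <- comul h) \tsum_(c, d <- comul a) f c d b =
  \tsum_(a, b <- comul h) \tsum_(c, d <- comul b) f a c d.
Proof.
move=> trif; case: (trif) => f1 f2 f3.
have := tlift_assoc (tmap comul idfun (comul h)) trif.
rewrite comulA !tlift_map; try by split; lin.
by [].
Qed.

Lemma counit_suml W (f : H -> W) h : linear f ->
  \tsum_(a, b <- comul h) (eps a : K) *: f b = f h.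
Proof.
move=> lf; rewrite -{2}[h]counitl (tlift_app _ _ lf).
by apply: eq_tlift => a b; rewrite (linZ lf).
Qed.

Lemma counit_sumr W (f : H -> W) h : linear f ->
  \tsum_(a, b <- comul h) (eps b : K) *: f a = f h.
Proof.
move=> lf; rewrite -{2}[h]counitr (tlift_app _ _ lf).
by apply: eq_tlift => a b; rewrite (linZ lf).
Qed.

Lemma antipode_suml W (f : H -> W) h : linear f ->
  \tsum_(a, b <- comul h) f (S a * b) = (eps h : K) *: f 1.
Proof. by move=> lf; rewrite -(linZ lf) -antipodel (tlift_app _ _ lf). Qed.

Lemma antipode_sumr W (f : H -> W) h : linear f ->
  \tsum_(a, b <- comul h) f (a * S b) = (eps h : K) *: f 1.
Proof. by move=> lf; rewrite -(linZ lf) -antipoder (tlift_app _ _ lf). Qed.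

Lemma antipode1 : S 1 = 1.
Proof.
have := antipodel (1 : H); rewrite !rmorph1 tliftE; last by split; lin.
by rewrite mulr1 scale1r.
Qed.

(** Both sides are convolution inverses of the product map on H (x) H. The sum
    of S(a_1 b_1) (a_2 b_2) (S(b_3) S(a_3)) contracts to S(b) S(a) if the first
    two factors are multiplied first, and to S(ab) if the last two are. *)
Lemma antipodeM a b : S (a * b) = S b * S a.
Proof.
pose f x y z := \tsum_(b1, b2 <- comul b) \tsum_(c, d <- comul b1)
  (S (x * c) * (y * d) * (S b2 * S z)).
have trif : trilin f by rewrite /f; split; lin.
have := tlift_coassoc a trif; rewrite {trif}/f.
under eq_tlift => a1 a2.
  rewrite exchange_tlift; under eq_tlift => b1 b2.
    rewrite -(@tlift_mul _ _ _ _ (fun x y => S x * y * (S b2 * S a2)));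
      last by split; lin.
    rewrite -rmorphM (antipode_suml (f := fun x => x * (S b2 * S a2)));
      last by lin.
    rewrite rmorphM mul1r /= mulrC -scalerA. over.
  rewrite (counit_suml (f := fun b2 => _ *: (S b2 * S a2))); last by lin. over.
rewrite (counit_suml (f := fun a2 => S b * S a2)); last by lin.
move->.
under eq_tlift => a1 a2; first under eq_tlift => c d.
  rewrite (tlift_coassoc
    (f := fun b1 b2 b3 => S (a1 * b1) * (c * b2) * (S b3 * S d)));
    last by split; lin.
  under eq_tlift => b1 b2.
    under eq_tlift => x y.
      rewrite mulrA -[_ * _ * S y]mulrA -[c * x * _]mulrA. over.
    rewrite (antipode_sumr (f := fun x => S (a1 * b1) * (c * x) * S d));
      last by lin.
    rewrite mulr1. over.
  rewrite (counit_sumr (f := fun b1 => S (a1 * b1) * c * S d)); last by lin.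
  rewrite -mulrA; over.
  rewrite (antipode_sumr (f := fun x => S (a1 * b) * x)); last by lin.
  rewrite mulr1. over.
by rewrite (counit_sumr (f := fun a1 => S (a1 * b))); last by lin.
Qed.

Lemma antipodeX x n : S (x ^+ n) = S x ^+ n.
Proof.
by elim: n => [|n IHn]; rewrite ?antipode1 // exprS antipodeM IHn -exprSr.
Qed.

Lemma antipode_unit x : x \is a GRing.unit -> S x \is a GRing.unit.
Proof.
move=> Ux; apply: (@falg_unitr _ _ _ (S x^-1)).
by rewrite -antipodeM mulVr ?antipode1.
Qed.

Lemma antipodeV x : x \is a GRing.unit -> S x^-1 = (S x)^-1.
Proof.
by move=> Ux; apply/esym/falg_invr; rewrite -antipodeM mulVr ?antipode1.
Qed.

(** Dual to [antipodeM]: Delta o S and the right-hand side are a left and a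
    right convolution inverse of Delta, in the algebra of linear maps from H to
    H (x) H. *)
Lemma comul_antipode h : comul (S h) = \tsum_(a, b <- comul h) (S b \ox S a).
Proof.
pose T x := \tsum_(a, b <- comul x) (S b \ox S a).
have linT : linear T by rewrite /T; lin.
have comulT x : \tsum_(a, b <- comul x) (comul a * T b) = (eps x : K)%:A.
  transitivity (\tsum_(a, b <- comul x) \tsum_(c, d <- comul a)
      \tsum_(y, z <- comul b) ((c * S z) \ox (d * S y))).
    apply: eq_tlift => a b; rewrite -[in LHS](tlift_tens (comul a)).
    rewrite (tlift_app (F := fun t => t * T b)); last by lin.
    apply: eq_tlift => c d.
    rewrite (tlift_app (F := fun t => _ * t)); last by lin.
    by apply: eq_tlift => y z; rewrite tensM.
  (* Regroup x_1, x_2, x_3, x_4 so that x_2 S(x_3) contracts first. *)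
  rewrite (tlift_coassoc (f := fun c d b =>
    \tsum_(y, z <- comul b) ((c * S z) \ox (d * S y)))); last by split; lin.
  under eq_tlift => a b.
    rewrite -(tlift_coassoc (f := fun d y z => (a * S z) \ox (d * S y)));
      last by split; lin.
    under eq_tlift => c z.
      rewrite (antipode_sumr (f := fun d => (a * S z) \ox d)); last by lin.
      over.
    rewrite (counit_suml (f := fun z => (a * S z) \ox 1)); last by lin.
    over.
  by rewrite (antipode_sumr (f := fun d => d \ox (1 : H))); last by lin.
have tri : trilin (fun x y z => comul (S x) * comul y * T z) by split; lin.
have {tri} := tlift_coassoc h tri.
under eq_tlift => a b.
  under eq_tlift => c d do rewrite -rmorphM.
  rewrite (antipode_suml (f := fun x => comul x * T b)); last by lin.
  rewrite rmorph1 mul1r. over.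
rewrite (counit_suml _ linT) -/(T h) => ->.
under eq_tlift => a b.
  under eq_tlift => c d do rewrite -mulrA.
  rewrite -(tlift_app (F := fun t => comul (S a) * t)); last by lin.
  rewrite comulT (linZ (f := fun t => comul (S a) * t)); last by lin.
  rewrite mulr1; over.
by rewrite (counit_sumr (f := fun a => comul (S a))); last by lin.
Qed.

Lemma counit_antipode h : eps (S h) = eps h.
Proof.
have := @antipode_suml K^o eps h (@lin_map _ _ _ _).
under eq_tlift => a b do rewrite rmorphM mulrC.
rewrite (counit_sumr (f := fun a => eps (S a) : K^o)); last by lin.
by rewrite rmorph1 => ->; rewrite /GRing.scale /= mulr1.
Qed.

Lemma tmap_antipodeM (s t : tensor H H) :
  tmap S S (s * t) = tmap S S t * tmap S S s.
Proof.
rewrite /tmap tlift_mul; last by split; lin.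
rewrite exchange_tlift [RHS](tlift_app (F := fun z => z * _)); last by lin.
apply: eq_tlift => a b.
rewrite [RHS](tlift_app (F := fun z => _ * z)); last by lin.
by apply: eq_tlift => c d; rewrite tensM !antipodeM.
Qed.

Lemma tmap_antipode_swap (t : tensor H H) :
  tmap S S (tswap t) = tswap (tmap S S t).
Proof.
rewrite /tmap tlift_swap; last by split; lin.
rewrite [RHS](tlift_app (F := fun t => tswap t)); last by lin.
by apply: eq_tlift => a b; rewrite tswap_tens.
Qed.

Lemma comul_antipode_swap h : comul (S h) = tswap (tmap S S (comul h)).
Proof.
rewrite comul_antipode /tmap (tlift_app (F := fun t => tswap t)); last by lin.
by apply: eq_tlift => a b; rewrite tswap_tens.
Qed.

End Antipode.

(** * The R-matrix *)

Section RMatrix.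
Variables (K : fieldType) (H : hopfAlgType K) (R : tensor H H).
Hypothesis qtR : quasitriangular R.
Implicit Types (a b h x y : H) (W : vectType K).

Notation S := (@antipode K H).
Notation eps := (@counit K H).

Lemma tlift_comulR W (f : H -> H -> H -> W) : trilin f ->
  \tsum_(a, b <- R) \tsum_(x, y <- comul a) f x y b =
  \tsum_(a, b <- R) \tsum_(c, d <- R) f a c (b * d).
Proof.
move=> [f1 f2 f3].
pose F : tensor (tensor H H) H -> W :=
  tlift (fun s c => \tsum_(x, y <- s) f x y c).
have bF : bilin (fun s c => \tsum_(x, y <- s) f x y c) by split; lin.
have linF : linear F by apply: tlift_linear.
have := congr1 F (qt_comull qtR); rewrite {1}/F tlift_map // => ->.
rewrite /leg13 /leg23 (tlift_app (F := fun t => F (t * _))); last by lin.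
apply: eq_tlift => a b.
rewrite (tlift_app (F := fun t => F (_ * t))); last by lin.
apply: eq_tlift => c d; rewrite !tensM mulr1 mul1r /F tliftE //.
by rewrite tliftE //; split; lin.
Qed.

Lemma tlift_Rcomul W (f : H -> H -> H -> W) : trilin f ->
  \tsum_(a, b <- R) \tsum_(x, y <- comul b) f a x y =
  \tsum_(a, b <- R) \tsum_(c, d <- R) f (a * c) d b.
Proof.
move=> trif; case: (trif) => f1 f2 f3.
pose F : tensor (tensor H H) H -> W :=
  tlift (fun s c => \tsum_(x, y <- s) f x y c).
have bF : bilin (fun s c => \tsum_(x, y <- s) f x y c) by split; lin.
have linF : linear F by apply: tlift_linear.
have := tlift_assoc (leg13 R * leg12 R) trif.
rewrite -(qt_comulr qtR) tlift_map; last by split; lin.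
move=> ->; rewrite -/(F _) /leg13 /leg12.
rewrite (tlift_app (F := fun t => F (t * _))); last by lin.
apply: eq_tlift => a b; rewrite -{1}(tlift_tens R).
rewrite (tlift_app (F := fun t => F (_ * (t \ox 1)))); last by lin.
apply: eq_tlift => c d; rewrite !tensM mulr1 mul1r /F tliftE //.
by rewrite tliftE //; split; lin.
Qed.

Lemma tlift_comul_op W (f : H -> H -> W) h : bilin f ->
  \tsum_(x, y <- comul h) \tsum_(a, b <- R) f (y * a) (x * b) =
  \tsum_(a, b <- R) \tsum_(x, y <- comul h) f (a * x) (b * y).
Proof.
move=> bf; rewrite -(tlift_mul _ _ bf) -(qt_comul_op qtR) tlift_mul //.
by rewrite tlift_swap //; split; lin.
Qed.

(** Killing the middle leg of (Delta (x) id)(R) = R_13 R_23 with the counit gives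
    R = R (1 (x) q) for q = (eps (x) id)(R), and R is invertible. *)
Lemma counit_R : \tsum_(a, b <- R) ((eps a : K) *: b) = 1.
Proof.
set q := (LHS).
suff /(congr1 (tlift (fun x y => (eps x : K) *: y))) :
    1 \ox q = 1 :> tensor H H.
  by rewrite !tliftE; try (by split; lin); rewrite rmorph1 !scale1r.
apply: (unitr_mul_fixed (qt_unit qtR)).
have tri : trilin (fun x y b => (eps y : K) *: (x \ox b)) by split; lin.
have {tri} := tlift_comulR tri.
under eq_tlift => a b.
  rewrite (counit_sumr (f := fun x => x \ox b)); last by lin. over.
rewrite tlift_tens => E; rewrite [LHS]E tmulr_tens.
apply: eq_tlift => a b.
rewrite mulr1 (tlift_app (F := fun y => a \ox (b * y))); last by lin.
by apply: eq_tlift => c d; rewrite -scalerAr (linZ (@tens_linearr _ _ _ a)).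
Qed.

Lemma R_counit : \tsum_(a, b <- R) ((eps b : K) *: a) = 1.
Proof.
set q := (LHS).
suff /(congr1 (tlift (fun x y => (eps y : K) *: x))) :
    q \ox 1 = 1 :> tensor H H.
  by rewrite !tliftE; try (by split; lin); rewrite rmorph1 !scale1r.
apply: (unitr_mul_fixed (qt_unit qtR)).
have tri : trilin (fun a x y => (eps x : K) *: (a \ox y)) by split; lin.
have {tri} := tlift_Rcomul tri.
under eq_tlift => a b.
  rewrite (counit_suml (f := fun y => a \ox y)); last by lin. over.
rewrite tlift_tens => E; rewrite [LHS]E tmulr_tens.
apply: eq_tlift => a b.
rewrite mulr1 (tlift_app (F := fun y => (a * y) \ox b)); last by lin.
by apply: eq_tlift => c d; rewrite -scalerAr (linZ (@tens_linearl _ _ _ b)).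
Qed.

(** Contract the first two legs of (Delta (x) id)(R) = R_13 R_23 with
    S(x) y. *)
Lemma R_inv : R^-1 = tmap S idfun R.
Proof.
have UR := qt_unit qtR; apply: (mulIr UR); rewrite mulVr //.
rewrite /tmap (tlift_app (F := fun t => t * R)); last by lin.
under eq_tlift => a b do rewrite tmull_tens.
rewrite -(@tlift_comulR _ (fun x y b => (S x * y) \ox b)); last by split; lin.
under eq_tlift => a b.
  rewrite (antipode_suml (f := fun x => x \ox b)); last by lin.
  rewrite -(linZ (@tens_linearr _ _ _ 1)). over.
rewrite -(tlift_app (F := fun y => 1 \ox y)); last by lin.
by rewrite counit_R.
Qed.

(** The companion of [R_inv] for the second leg: contracting the last two legs
    of (id (x) Delta)(R) = R_13 R_12 shows that (id (x) S)(R) is inverse to R in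
    H (x) H^op. It is the only cancellation that the computation of Delta(u)
    uses, and it avoids the inverse of the antipode. *)
Lemma tlift_R_cancel W (f : H -> H -> W) : bilin f ->
  \tsum_(a, b <- R) \tsum_(c, d <- R) f (a * c) (S d * b) = f 1 1.
Proof.
move=> bf.
rewrite -(@tlift_Rcomul _ (fun a x y => f a (S x * y))); last by split; lin.
under eq_tlift => a b.
  rewrite (antipode_suml (f := fun x => f a x)); last by lin.
  rewrite -(linZ (f := fun a => f a 1)); last by lin.
  over.
by rewrite -(tlift_app (F := fun a => f a 1)) ?R_counit //; lin.
Qed.

(** Applying S to the first leg of the previous cancellation turns it into
    (S (x) S)(R) R^-1 = 1. *)
Lemma R_antipode2 : tmap S S R = R.
Proof.
have UR := qt_unit qtR; have UV : R^-1 \is a GRing.unit by rewrite unitrV.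
apply: (mulIr UV); rewrite mulrV // R_inv.
rewrite /tmap (tlift_app (F := fun t => t * _)); last by lin.
under eq_tlift => a b.
  rewrite (tlift_app (F := fun t => _ * t)); last by lin.
  under eq_tlift => c d do rewrite tensM -antipodeM.
  over.
rewrite exchange_tlift (@tlift_R_cancel _ (fun x y => S x \ox y));
  last by split; lin.
by rewrite antipode1.
Qed.

Notation Q := (tswap R * R).

Lemma monodromy_unit : Q \is a GRing.unit.
Proof.
have UR := qt_unit qtR; rewrite unitrMl //.
apply: (@falg_unitr _ _ _ (tswap R^-1)).
by rewrite -tswapM mulrV // tswap_tens.
Qed.

(** R and R_21 each turn Delta into its opposite and back. *)
Lemma monodromy_comul h : Q * comul h = comul h * Q.
Proof.
have := congr1 (fun t => tswap t) (qt_comul_op qtR h).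
rewrite !tswapM tswapK mulrA => ->.
by rewrite -!mulrA (qt_comul_op qtR).
Qed.

(** * The Drinfeld element *)

Notation u := (drinfeld R).

(** Sum S^2(h_3) S(y) x, where x (x) y runs over the components of the two sides
    of h_2 R_i (x) h_1 R^i = R_i h_1 (x) R^i h_2. The left side contracts
    S(h_1) h_2 and leaves S^2(h) u, the right side contracts h_2 S(h_3) and
    leaves u h. *)
Lemma drinfeld_antipode2 h : S (S h) * u = u * h.
Proof.
pose F (p : H -> H) := \tsum_(x, z <- comul h) (S (S z) * p x).
transitivity (F (fun x =>
    \tsum_(p, q <- comul x) \tsum_(a, b <- R) (S (p * b) * (q * a)))).
  rewrite /F; under [RHS]eq_tlift => x z.
    rewrite exchange_tlift; under eq_tlift => a b.
      under eq_tlift => p q do rewrite antipodeM -mulrA (mulrA _ q).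
      rewrite (antipode_suml (f := fun y => S b * (y * a))); last by lin.
      rewrite mul1r; over.
    rewrite (_ : tlift _ _ = (eps x : K) *: u); last first.
      rewrite /drinfeld (tlift_app (F := fun y => (eps x : K) *: y)) //.
      by lin.
    rewrite -scalerAr. over.
  by rewrite (counit_suml (f := fun z => S (S z) * u)); last by lin.
rewrite /F; under eq_tlift => x z.
  rewrite (@tlift_comul_op _ (fun a b => S b * a)); last by split; lin.
  rewrite (tlift_app (F := fun y => S (S z) * y)); last by lin.
  under eq_tlift => a b.
    rewrite (tlift_app (F := fun y => S (S z) * y)); last by lin. over.
  over.
rewrite exchange_tlift [in RHS]/drinfeld.
rewrite (tlift_app (F := fun y => y * h)); last by lin.
apply: eq_tlift => a b.
rewrite (@tlift_coassoc _ _ _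
  (fun p q z => S (S z) * (S (b * q) * (a * p)))); last by split; lin.
under eq_tlift => p r.
  under eq_tlift => q z do rewrite antipodeM !mulrA -antipodeM -!mulrA.
  rewrite (antipode_sumr (f := fun x => S x * (S b * (a * p)))); last by lin.
  rewrite antipode1 mul1r. over.
by rewrite (counit_sumr (f := fun p => S b * (a * p))) ?mulrA //; lin.
Qed.

(** The inverse is the sum of R^i S^2(R_i). Moving u past R^i turns the product
    into the image of R (S^2 (x) S)(R) = R R^-1 under the map sending x (x) y to
    S(y) x. *)
Lemma drinfeld_unit : u \is a GRing.unit.
Proof.
pose w := \tsum_(a, b <- R) (b * S (S a)).
apply: (@falg_unitr _ _ _ w).
rewrite /w (tlift_app (F := fun y => u * y)); last by lin.
under eq_tlift => a b.
  rewrite mulrA -drinfeld_antipode2 -mulrA /drinfeld.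
  rewrite (tlift_app (F := fun y => _ * (y * _))); last by lin.
  under eq_tlift => c d do rewrite !mulrA -antipodeM -mulrA.
  over.
rewrite exchange_tlift.
pose G : tensor H H -> H := tlift (fun x y => S y * x).
have bG : bilin (fun x y => S y * x) by split; lin.
have := congr1 G (mulrV (qt_unit qtR)).
rewrite {2}/G tliftE // antipode1 mulr1 => <-.
rewrite R_inv -[in tmap S idfun _]R_antipode2 /G tlift_mul //.
apply: eq_tlift => c d.
rewrite tlift_map; last by split; lin.
by rewrite tlift_map //; split; lin.
Qed.

Lemma antipode2_drinfeld : S (S u) = u.
Proof. by apply: (mulIr drinfeld_unit); rewrite drinfeld_antipode2. Qed.

Lemma drinfeld_comm_antipode : GRing.comm u (S u).
Proof. by rewrite /GRing.comm -drinfeld_antipode2 antipode2_drinfeld. Qed.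

Lemma antipode_drinfeld_antipode2 h : S u * S (S (S h)) = S h * S u.
Proof. by rewrite -!antipodeM drinfeld_antipode2. Qed.

Lemma counit_drinfeld : eps u = 1.
Proof.
transitivity (eps (\tsum_(a, b <- R) ((eps b : K) *: a))); last first.
  by rewrite R_counit rmorph1.
rewrite /drinfeld !(tlift_app _ _ (@lin_map _ _ _ eps)).
by apply: eq_tlift => a b; rewrite rmorphM linearZ /= counit_antipode.
Qed.

(** After expanding (id (x) Delta)(R), the factor R_21 is absorbed by one of the
    two copies of R through [tlift_R_cancel]; the other copy yields u. *)
Lemma comul_antipode_swapR :
  \tsum_(a, b <- R) \tsum_(x, y <- comul b)
     ((S y \ox S x) * tswap R * (1 \ox a)) = 1 \ox u.
Proof.
rewrite (@tlift_Rcomul _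
  (fun a x y => (S y \ox S x) * tswap R * (1 \ox a))); last by split; lin.
pose f x y := \tsum_(c, d <- R) (y \ox (S d * (x * c))).
transitivity (\tsum_(p, q <- R) \tsum_(a, b <- R) f (p * a) (S b * q)).
  rewrite [RHS]exchange_tlift; apply: eq_tlift => a b.
  rewrite /f [RHS]exchange_tlift; apply: eq_tlift => c d.
  rewrite {1}/tswap (tlift_app (F := fun t => _ * t * _)); last by lin.
  by apply: eq_tlift => p q; rewrite !tensM mulr1 !mulrA.
rewrite tlift_R_cancel; last by rewrite /f; split; lin.
rewrite /f -(tlift_app (F := fun y => 1 \ox y)); last by lin.
by under eq_tlift => c d do rewrite mul1r.
Qed.

(** Write Delta(u) as the sum of Delta(S(b)) Delta(a). Since Q commutes with
    Delta(S(b)) and R Delta(a) = Delta^op(a) R, the product Q Delta(u) is the sum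
    of Delta(S(b)) R_21 Delta^op(a) R. Expanding both coproducts with the hexagon
    identities leaves four copies of R besides R_21 and R: two of them cancel
    against R_21 and R, the other two give u (x) u. *)
Lemma comul_drinfeld : Q * comul u = u \ox u.
Proof.
rewrite {1}/drinfeld (tlift_app (F := comul)); last by lin.
rewrite (tlift_app (F := fun t => _ * t)); last by lin.
transitivity (\tsum_(a, b <- R) \tsum_(x, y <- comul a)
    (comul (S b) * tswap R * (y \ox x) * R)).
  apply: eq_tlift => a b; rewrite rmorphM mulrA monodromy_comul -!mulrA.
  rewrite -(qt_comul_op qtR) [tswap (comul a)]/tswap.
  rewrite (tlift_app (F := fun t => _ * (_ * (t * _)))); last by lin.
  by apply: eq_tlift => x y; rewrite -!mulrA.
rewrite (@tlift_comulR (tensor H H)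
  (fun x y b => comul (S b) * tswap R * (y \ox x) * R)); last by split; lin.
rewrite exchange_tlift.
(* The copy of R that meets R_21 cancels. *)
transitivity (\tsum_(c, d <- R) (comul (S d) * (c \ox u) * R)).
  apply: eq_tlift => c d.
  rewrite [in RHS](_ : c \ox u = (1 \ox u) * (c \ox 1)); last first.
    by rewrite tensM mulr1 mul1r.
  rewrite -comul_antipode_swapR (tlift_app (F := fun t => _ * (t * _) * _));
    last by lin.
  apply: eq_tlift => a b; rewrite antipodeM rmorphM /= (comul_antipode b).
  rewrite (tlift_app (F := fun t => _ * t * _ * _ * _)); last by lin.
  rewrite (tlift_app (F := fun t => _ * (t * _) * _)); last by lin.
  apply: eq_tlift => x y.
  by rewrite -!mulrA (mulrA (1 \ox a)) tensM mulr1 mul1r.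
(* The copy of R that meets the final R cancels once u is moved to the right. *)
have Ru : \tsum_(a, b <- R) ((1 \ox S b) * (a \ox u) * R) = 1 \ox u.
  transitivity (\tsum_(a, b <- R) \tsum_(c, d <- R)
      ((a * c) \ox (S (S d * b) * u))).
    apply: eq_tlift => a b; rewrite tensM mul1r tmull_tens.
    by apply: eq_tlift => c d; rewrite antipodeM -!mulrA drinfeld_antipode2.
  rewrite (@tlift_R_cancel _ (fun x y => x \ox (S y * u))); last by split; lin.
  by rewrite antipode1 mul1r.
under eq_tlift => c d.
  rewrite comul_antipode (tlift_app (F := fun t => t * _ * _)); last by lin.
  over.
rewrite (@tlift_Rcomul _ (fun a x y => (S y \ox S x) * (a \ox u) * R));
  last by split; lin.
transitivity (\tsum_(a, b <- R) ((S b * a) \ox 1 * (1 \ox u))).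
  apply: eq_tlift => a b.
  rewrite -Ru (tlift_app (F := fun t => _ * t)); last by lin.
  by apply: eq_tlift => c d; rewrite !mulrA !tensM mul1r !mulrA mulr1.
rewrite -(tlift_app (F := fun y => y \ox 1 * (1 \ox u))); last by lin.
by rewrite tensM mul1r mulr1.
Qed.

Lemma comul_drinfeldE : comul u = (u \ox u) * Q^-1.
Proof.
have UQ := monodromy_unit; apply: (mulIr UQ).
by rewrite (mulrVK UQ) -monodromy_comul comul_drinfeld.
Qed.

(** Apply S (x) S and then the flip to [comul_drinfeld]; Q is fixed, because
    these maps reverse the product and exchange R and R_21. *)
Lemma comul_antipode_drinfeld : comul (S u) * Q = S u \ox S u.
Proof.
have := congr1 (fun t => tswap (tmap S S t)) comul_drinfeld.
rewrite !tmap_antipodeM !tswapM -comul_antipode_swap tmap_antipode_swap.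
rewrite R_antipode2 tswapK => ->.
by rewrite /tmap tliftE ?tswap_tens //; split; lin.
Qed.

End RMatrix.

(** * Group-like elements *)

(** Lagrange's theorem for a finite group of units given as a set; the set is
    made into an abstract finite group in order to use the theory of those. *)
Lemma expr_card_group (A : unitRingType) (G : set A) N :
  G 1 -> (forall x y, G x -> G y -> G (x * y)) ->
  (forall x, G x -> x \is a GRing.unit /\ G x^-1) ->
  G #= `I_N -> forall x, G x -> x ^+ N = 1.
Proof.
move=> G1 GM GV cardG.
have finG : finite_set G by exists N.
have GE x : (x \in fset_set G) = (x \in G) by rewrite in_fset_set.
have inG x : G x -> x \in fset_set G by rewrite GE => /mem_set.
have Gin (x : fset_set G) : G (val x) by apply/set_mem; rewrite -GE (valP x).
pose T : finType := fset_set G.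
pose mul (x y : T) : T := FSetSub (inG _ (GM _ _ (Gin x) (Gin y))).
pose one : T := FSetSub (inG _ G1).
pose inv (x : T) : T := FSetSub (inG _ (GV _ (Gin x)).2).
have mulA : associative mul by move=> x y z; apply: val_inj; rewrite /= mulrA.
have mul1 : left_id one mul by move=> x; apply: val_inj; rewrite /= mul1r.
have mulV : left_inverse one inv mul.
  by move=> x; apply: val_inj; rewrite /= mulVr // (GV _ (Gin x)).1.
pose gT : finGroupType := HB.pack T (Finite_isGroup.Build T mulA mul1 mulV).
move=> x Gx; pose x' : gT := FSetSub (inG _ Gx).
have vX n : val (x' ^+ n)%g = x ^+ n.
  by elim: n => [//|n IHn]; rewrite expgS exprS -IHn.
have := expg_cardG (finset.in_setT x').
move/(congr1 val); rewrite vX finset.cardsT.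
by rewrite (_ : #|gT| = N) // -(card_fset_set cardG) cardfE.
Qed.

Section GroupLikes.
Variables (K : fieldType) (H : hopfAlgType K).
Implicit Types x y : H.

Notation eps := (@counit K H).

Lemma counit_group_like x : group_likes H x -> eps x = 1.
Proof.
case=> x0 cx; have := counitl x; rewrite cx tliftE; last by split; lin.
move=> e; have /eqP : ((eps x : K) - 1) *: x = 0.
  by rewrite scalerBl scale1r [_ *: _]e subrr.
by rewrite scaler_eq0 (negPf x0) orbF subr_eq0 => /eqP.
Qed.

Lemma group_like_unit x : group_likes H x -> x \is a GRing.unit.
Proof.
move=> Gx; have := antipoder x; rewrite (counit_group_like Gx) scale1r.
case: Gx => _ ->; rewrite tliftE; last by split; lin.
exact: falg_unitr.
Qed.

Lemma unit_group_like x :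
  x \is a GRing.unit -> comul x = x \ox x -> group_likes H x.
Proof.
by move=> Ux cx; split=> //; apply/eqP => x0; move: Ux; rewrite x0 unitr0.
Qed.

Lemma group_like1 : group_likes H 1.
Proof. by apply: unit_group_like; rewrite ?unitr1 ?rmorph1. Qed.

Lemma group_likeM x y :
  group_likes H x -> group_likes H y -> group_likes H (x * y).
Proof.
move=> Gx Gy; apply: unit_group_like; first by rewrite unitrMl !group_like_unit.
by case: Gx Gy => _ cx [_ cy]; rewrite rmorphM /= cx cy tensM.
Qed.

Lemma group_likeV x : group_likes H x -> group_likes H x^-1.
Proof.
move=> Gx; have Ux := group_like_unit Gx.
apply: unit_group_like; first by rewrite unitrV.
by rewrite rmorphV //= Gx.2 tens_inv.
Qed.

Lemma group_likeX x n : group_likes H x -> group_likes H (x ^+ n).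
Proof.
move=> Gx; elim: n => [|n IHn]; first exact: group_like1.
by rewrite exprS; apply: group_likeM.
Qed.

Lemma group_like_expr N x :
  group_likes H #= `I_N -> group_likes H x -> x ^+ N = 1.
Proof.
move=> cardG; apply: expr_card_group cardG x; first exact: group_like1.
- exact: group_likeM.
- by move=> x Gx; split; [exact: group_like_unit | exact: group_likeV].
Qed.

End GroupLikes.

(** * The element g and the fourth power of the antipode *)

Section DrinfeldQuotient.
Variables (K : fieldType) (H : hopfAlgType K) (R : tensor H H).
Hypothesis qtR : quasitriangular R.

Notation S := (@antipode K H).
Notation u := (drinfeld R).
Notation g := (u * S u^-1).

Let Uu : u \is a GRing.unit := drinfeld_unit qtR.
Let USu : S u \is a GRing.unit := antipode_unit Uu.

Lemma quotientE : g = u * (S u)^-1.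
Proof. by rewrite (antipodeV Uu). Qed.

Lemma quotientK : g * S u = u.
Proof. by rewrite quotientE mulrVK. Qed.

(** Multiplying Delta(g) by Delta(S(u)) Q = S(u) (x) S(u) gives
    Delta(u) Q = u (x) u. *)
Lemma quotient_group_like : group_likes H g.
Proof.
have UQ := monodromy_unit qtR.
apply: unit_group_like; first by rewrite quotientE unitrMl ?unitrV.
have e : comul g * comul (S u) = comul u by rewrite -rmorphM quotientK.
have UcSu : comul (S u) \is a GRing.unit by apply: rmorph_unit.
apply: (mulIr UcSu); apply: (mulIr UQ).
rewrite e (comul_drinfeldE qtR) (mulrVK UQ) -[RHS]mulrA.
by rewrite (comul_antipode_drinfeld qtR) tensM quotientK.
Qed.

Hypothesis surjS : forall h : H, exists k, h = S k.

(** u conjugates by S^2, and S(u) by S^-2: the latter comes from applying S to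
    the former, which is why h has to be in the image of S. *)
Lemma antipode4_conj h : iter 4 S h * g = g * h.
Proof.
have [k ->] := surjS h.
have e : S (S (S k)) * (S u)^-1 = (S u)^-1 * S k.
  apply: (mulrI USu); rewrite mulVKr // mulrA.
  by rewrite (antipode_drinfeld_antipode2 qtR) mulrK.
by rewrite /= quotientE mulrA (drinfeld_antipode2 qtR) -(mulrA u) -e mulrA.
Qed.

Lemma antipode4X_conj j h : iter (4 * j) S h * g ^+ j = g ^+ j * h.
Proof.
elim: j h => [|j IHj] h; first by rewrite muln0 mulr1 mul1r.
by rewrite mulnS iterD exprS mulrA antipode4_conj -!mulrA IHj.
Qed.

End DrinfeldQuotient.

(** * Existence and uniqueness of the ribbon element *)

Theorem proposition3p4 (K : closedFieldType) (charK0 : [pchar K] =i pred0)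
    (H : hopfAlgType K) (R : tensor H H) (qtR : quasitriangular R)
    (GZ1 : group_likes H `&` [set` 'Z({:H})%VS] = [set 1])
    (m : nat) (cardG : group_likes H #= `I_(2 * m - 1))
    (n : nat) (odd_n : odd n)
    (antipode_order : forall h : H, iter (2 * n) antipode h = h) :
  let u := drinfeld R in
  let g := u * antipode u^-1 in
  unique (is_ribbon R) (g ^- m * u).
Proof.
move=> u g.
have centerP (x : H) : (x \in 'Z({:H})%VS) <-> (forall y, x * y = y * x).
  rewrite memv_cap memvf /=; split=> [/centvP cx y|cx].
    exact/cx/memvf.
  by apply/centvP => y _.
have n_gt0 : (0 < n)%N by case: n odd_n {antipode_order}.
have surjS (h : H) : exists k, h = antipode k.
  exists (iter (2 * n).-1 antipode h).
  by rewrite -iterS prednK ?muln_gt0 // antipode_order.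
have Uu : u \is a GRing.unit := drinfeld_unit qtR.
have USu := antipode_unit Uu; have SuV := antipodeV Uu.
have Gg : group_likes H g := quotient_group_like qtR.
have Ug := group_like_unit Gg.
have gSu : g * antipode u = u := quotientK qtR.
have g4 := antipode4X_conj qtR surjS; rewrite -/u -/g in g4.
have lagrange x : group_likes H x -> x ^+ (2 * m - 1) = 1.
  exact: group_like_expr.
(* For m = 0 the subtraction truncates to 0, but 1 is group-like. *)
have m_gt0 : (0 < m)%N.
  rewrite lt0n; apply/eqP => m0; move: cardG; rewrite m0 II0 card_eq0 => /eqP G0.
  by have := group_like1 H; rewrite G0.
have expr2m x : group_likes H x -> x ^+ (2 * m) = x.
  move=> Gx; rewrite -{2}[x]mul1r -(lagrange x Gx) -exprSr subn1 prednK //.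
  by rewrite muln_gt0.
have gn1 : g ^+ n = 1.
  have : (group_likes H `&` [set` 'Z({:H})%VS]) (g ^+ n).
    split; first exact: group_likeX.
    apply/centerP => h; rewrite -g4; congr (_ * _).
    have -> : (4 * n = 2 * n + 2 * n)%N by rewrite -mulnDl.
    by rewrite iterD !antipode_order.
  by rewrite GZ1.
have nE : n.+1 = (2 * n./2.+1)%N.
  by rewrite -[in LHS](odd_double_half n) odd_n mul2n doubleS.
(* Both sides are square roots of g in a group of odd order. *)
have gm : g ^+ m = g ^+ n./2.+1.
  by rewrite -[in RHS](expr2m g Gg) -exprM mulnAC -nE exprM exprSr gn1 mul1r.
have S2 h : antipode (antipode h) * g ^+ m = g ^+ m * h.
  rewrite gm -g4; congr (_ * _).
  have -> : (4 * n./2.+1 = 2 + 2 * n)%N.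
    by rewrite -[4%N]/(2 * 2)%N -mulnA -nE mulnS.
  by rewrite iterD antipode_order.
have cuS : GRing.comm u (antipode u) := drinfeld_comm_antipode qtR.
have gu : GRing.comm u g by rewrite /g SuV; apply: commrM => //; apply: commrV.
have gSu_comm : GRing.comm (antipode u) g.
  by rewrite /g SuV; apply: commrM; [exact: commr_sym | exact: commrV].
have Ugm : g ^+ m \is a GRing.unit by rewrite unitrX.
have g2m : g ^+ m * g ^+ m = g by rewrite -exprD addnn -mul2n expr2m.
have Sg : antipode g = g^-1.
  rewrite /g antipodeM SuV (antipodeV USu) (antipode2_drinfeld qtR) -/u.
  by rewrite invrM ?unitrV // invrK; apply/commr_sym/commrV/commr_sym.
have gVu : g^-1 * u = antipode u by rewrite -{1}gSu mulKr.
have gmVu : GRing.comm u (g ^- m) by apply/commrV/commrX.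
have v_comm h : g ^- m * u * h = h * (g ^- m * u).
  apply: (mulrI Ugm); rewrite !mulrA (mulrV Ugm) mul1r -S2 mulrK //.
  by rewrite (drinfeld_antipode2 qtR).
split.
  split.
  - exact/centerP.
  - rewrite expr2 mulrA -[_ * u * _]mulrA gmVu !mulrA -invrM // g2m gVu.
    exact/esym/cuS.
  - rewrite antipodeM (antipodeV Ugm) antipodeX Sg exprVn invrK.
    apply: (mulrI Ugm); rewrite mulVKr // mulrA -commrX //.
    by rewrite -mulrA g2m gSu_comm.
  - have : counit (g ^+ m) * counit (g ^- m * u) = 1.
      by rewrite -rmorphM mulVKr //; exact: counit_drinfeld.
    by rewrite (counit_group_like (group_likeX m Gg)) mul1r.
  - rewrite rmorphM /= (comul_drinfeldE qtR) -/u.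
    by rewrite (group_likeV (group_likeX m Gg)).2 mulrA tensM.
move=> v [/centerP v_central v2 _ _ cv].
have Uv : v \is a GRing.unit.
  by rewrite -(unitrX_pos v (isT : 0 < 2)%N) v2 unitrMl.
pose l := u * v^-1.
have lv : l * v = u by rewrite mulrVK.
have Gl : group_likes H l.
  apply: unit_group_like; first by rewrite unitrMl ?unitrV.
  have Ucv : comul v \is a GRing.unit by apply: rmorph_unit.
  apply: (mulIr Ucv).
  by rewrite -rmorphM lv /= (comul_drinfeldE qtR) cv mulrA tensM lv.
have l2 : l ^+ 2 = g.
  apply: (mulIr USu); rewrite gSu; apply: (mulIr Uu).
  rewrite -mulrA -cuS -v2 !expr2 -mulrA [l * (v * v)]mulrA lv.
  by rewrite -v_central mulrA lv.
apply: (mulrI Ugm); rewrite mulVKr //.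
by rewrite -l2 -exprM expr2m // lv.
Qed.
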